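(* The center defines a lax functor $\mathcal Z\colon\mathsf{Ring}\to\mathsf{coSpan}(\mathsf{Ring})$ (with $\mathsf{Ring}$ regarded as a bicategory with only identity 2-morphisms). That is, there is a lax functor $\mathcal Z$ which sends each ring $R$ to its center $Z(R)$ and each ring homomorphism $f\colon R\to S$ to the cospan $$\mathcal Z(f)=\left(Z(R)\xrightarrow{\ \alpha_R\ }Z(f)\xleftarrow{\ \alpha_S\ }Z(S)\right),$$ where $Z(f)=\{s\in S\mid s f(r)=f(r)s\text{ for all } r\in R\}$ is the centralizer of $f$, a subring of $S$, and $\alpha_R(r)=f(r)$ for $r\in Z(R)$, $\alpha_S(s)=s$ for $s\in Z(S)$.
   Context: Rings are unital and associative (not necessarily commutative); ring homomorphisms preserve the unit; $\mathsf{Ring}$ is the category of such rings. $Z(R)$ denotes the center of $R$. For a category $\mathcal C$ with small colimits, choose for every pair of morphisms with common source an explicit pushout. The bicategory $\mathsf{coSpan}(\mathcal C)$ has the same objects as $\mathcal C$; a 1-morphism from $X$ to $Y$ is a cospan $X\xrightarrow{f_X}W\xleftarrow{f_Y}Y$ in $\mathcal C$; a 2-morphism from $X\to W\leftarrow Y$ to $X\to W'\leftarrow Y$ is a morphism $\delta\colon W\to W'$ in $\mathcal C$ commuting with the maps from $X$ and from $Y$ (identities on $X$ and $Y$). The composite of $X\to W\leftarrow Y$ with $Y\to V\leftarrow Z$ is the cospan $X\to P\leftarrow Z$, where $P$ is the chosen pushout of $W\leftarrow Y\to V$ and the legs are the composites $X\to W\to P$ and $Z\to V\to P$. The identity 1-morphism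 of $X$ is $X\xrightarrow{\mathrm{id}}X\xleftarrow{\mathrm{id}}X$; associator and unitors are the canonical isomorphisms of pushouts. In $\mathsf{Ring}$, pushouts are amalgamated free products. A lax functor $P\colon\mathcal A\to\mathcal B$ between bicategories consists of: a function $P$ on objects; functors $P_{X,Y}\colon\mathcal A(X,Y)\to\mathcal B(P(X),P(Y))$ on hom-categories (all written $P$ below); for each object $X$ a 2-cell $P_{\mathrm{id}_X}\colon \mathrm{id}_{P(X)}\Rightarrow P(\mathrm{id}_X)$; and for composable $f\colon X\to Y$, $g\colon Y\to Z$ a 2-cell $P_{g,f}\colon P(g)\circ P(f)\Rightarrow P(g\circ f)$, natural in $f$ and $g$. With $\alpha\colon (h\circ g)\circ f\Rightarrow h\circ(g\circ f)$ the associator and $\ell\colon \mathrm{id}\circ f\Rightarrow f$, $r\colon f\circ\mathrm{id}\Rightarrow f$ the unitors, and $*$ denoting horizontal composition, these must satisfy, for $f\colon W\to X$, $g\colon X\to Y$, $h\colon Y\to Z$: (Lax unity) $P(\ell_{\mathcal A})\cdot P_{\mathrm{id}_X,f}\cdot(P_{\mathrm{id}_X}*\mathrm{id}_{P(f)})=\ell_{\mathcal B}$ and $P(r_{\mathcal A})\cdot P_{f,\mathrm{id}_W}\cdot(\mathrm{id}_{P(f)}*P_{\mathrm{id}_W})=r_{\mathcal B}$; (Lax associativity) $P(\alpha_{\mathcal A})\cdot P_{h\circ g,f}\cdot(P_{h,g}*\mathrm{id}_{P(f)})=P_{h,g\circ f}\cdot(\mathrm{id}_{P(h)}*P_{g,f})\cdot\alpha_{\mathcal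 B}$. *)

(* Defs.v *)
From HB Require Import structures.
From mathcomp Require Import all_boot all_algebra generic_quotient boolp.

Set Implicit Arguments.
Unset Strict Implicit.
Unset Printing Implicit Defensive.

Import GRing.Theory.
Local Open Scope ring_scope.

Declare Scope cat_scope.
Delimit Scope cat_scope with cat.

Record category := Category {
  ob :> Type;
  hom : ob -> ob -> Type;
  idm : forall X, hom X X;
  compose : forall X Y Z, hom Y Z -> hom X Y -> hom X Z;
  comp_idl : forall X Y (f : hom X Y), compose (idm Y) f = f;
  comp_idr : forall X Y (f : hom X Y), compose f (idm X) = f;
  compA : forall W X Y Z (h : hom Y Z) (g : hom X Y) (f : hom W X),
    compose h (compose g f) = compose (compose h g) f
}.
Arguments hom {C} X Y : rename.
Arguments idm {C} X : rename.
Arguments compose {C X Y Z} g f : rename.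
Arguments comp_idl {C X Y} f : rename.
Arguments comp_idr {C X Y} f : rename.
Arguments compA {C W X Y Z} h g f : rename.

Notation "g '\c' f" := (compose g f) (at level 40, left associativity) : cat_scope.
Local Open Scope cat_scope.

Definition is_iso (C : category) (X Y : C) (f : hom X Y) : Prop :=
  exists g : hom Y X, g \c f = idm X /\ f \c g = idm Y.

Record functor (C D : category) := Functor {
  fob :> C -> D;
  fmap : forall X Y : C, hom X Y -> hom (fob X) (fob Y);
  fmap_id : forall X : C, fmap (idm X) = idm (fob X);
  fmap_comp : forall (X Y Z : C) (g : hom Y Z) (f : hom X Y),
    fmap (g \c f) = fmap g \c fmap f
}.
Arguments fmap {C D} F {X Y} f : rename.

(* 1-cells are the objects and 2-cells the morphisms of the hom-categories
   [hcat X Y], so [\c] between 2-cells is vertical composition;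
   [comp1 g f] is g o f and [comp2 b a] is the horizontal composite b * a. *)
Record bicategory := Bicategory {
  bob :> Type;
  hcat : bob -> bob -> category;
  id1 : forall X, hcat X X;
  comp1 : forall X Y Z, hcat Y Z -> hcat X Y -> hcat X Z;
  comp2 : forall X Y Z (g g' : hcat Y Z) (f f' : hcat X Y),
    hom g g' -> hom f f' -> hom (comp1 g f) (comp1 g' f');
  comp2_id : forall X Y Z (g : hcat Y Z) (f : hcat X Y),
    comp2 (idm g) (idm f) = idm (comp1 g f);
  comp2_comp : forall X Y Z (g g' g'' : hcat Y Z) (f f' f'' : hcat X Y)
      (b' : hom g' g'') (b : hom g g') (a' : hom f' f'') (a : hom f f'),
    comp2 (b' \c b) (a' \c a) = comp2 b' a' \c comp2 b a;
  assoc : forall W X Y Z (h : hcat Y Z) (g : hcat X Y) (f : hcat W X),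
    hom (comp1 (comp1 h g) f) (comp1 h (comp1 g f));
  assoc_iso : forall W X Y Z (h : hcat Y Z) (g : hcat X Y) (f : hcat W X),
    is_iso (assoc h g f);
  assoc_nat : forall W X Y Z (h h' : hcat Y Z) (g g' : hcat X Y)
      (f f' : hcat W X) (c : hom h h') (b : hom g g') (a : hom f f'),
    assoc h' g' f' \c comp2 (comp2 c b) a
    = comp2 c (comp2 b a) \c assoc h g f;
  lunit : forall X Y (f : hcat X Y), hom (comp1 (id1 Y) f) f;
  lunit_iso : forall X Y (f : hcat X Y), is_iso (lunit f);
  lunit_nat : forall X Y (f f' : hcat X Y) (a : hom f f'),
    lunit f' \c comp2 (idm (id1 Y)) a = a \c lunit f;
  runit : forall X Y (f : hcat X Y), hom (comp1 f (id1 X)) f;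
  runit_iso : forall X Y (f : hcat X Y), is_iso (runit f);
  runit_nat : forall X Y (f f' : hcat X Y) (a : hom f f'),
    runit f' \c comp2 a (idm (id1 X)) = a \c runit f;
  triangle : forall X Y Z (g : hcat Y Z) (f : hcat X Y),
    comp2 (idm g) (lunit f) \c assoc g (id1 Y) f = comp2 (runit g) (idm f);
  pentagon : forall V W X Y Z (k : hcat Y Z) (h : hcat X Y) (g : hcat W X)
      (f : hcat V W),
    assoc k h (comp1 g f) \c assoc (comp1 k h) g f
    = comp2 (idm k) (assoc h g f) \c assoc k (comp1 h g) f
        \c comp2 (assoc k h g) (idm f)
}.
Arguments hcat {B} X Y : rename.
Arguments id1 {B} X : rename.
Arguments comp1 {B X Y Z} g f : rename.
Arguments comp2 {B X Y Z g g' f f'} _ _ : rename.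
Arguments assoc {B W X Y Z} h g f : rename.
Arguments lunit {B X Y} f : rename.
Arguments runit {B X Y} f : rename.

Record lax_functor (A B : bicategory) := LaxFunctor {
  lax_ob :> A -> B;
  lax_hom : forall X Y : A, functor (hcat X Y) (hcat (lax_ob X) (lax_ob Y));
  lax_id : forall X : A, hom (id1 (lax_ob X)) (lax_hom X X (id1 X));
  lax_comp : forall (X Y Z : A) (g : hcat Y Z) (f : hcat X Y),
    hom (comp1 (lax_hom Y Z g) (lax_hom X Y f)) (lax_hom X Z (comp1 g f));
  lax_comp_nat : forall (X Y Z : A) (g g' : hcat Y Z) (f f' : hcat X Y)
      (b : hom g g') (a : hom f f'),
    lax_comp g' f' \c comp2 (fmap (lax_hom Y Z) b) (fmap (lax_hom X Y) a)
    = fmap (lax_hom X Z) (comp2 b a) \c lax_comp g f;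
  lax_lunit : forall (X Y : A) (f : hcat X Y),
    fmap (lax_hom X Y) (lunit f) \c lax_comp (id1 Y) f
      \c comp2 (lax_id Y) (idm (lax_hom X Y f))
    = lunit (lax_hom X Y f);
  lax_runit : forall (W X : A) (f : hcat W X),
    fmap (lax_hom W X) (runit f) \c lax_comp f (id1 W)
      \c comp2 (idm (lax_hom W X f)) (lax_id W)
    = runit (lax_hom W X f);
  lax_assoc : forall (W X Y Z : A) (h : hcat Y Z) (g : hcat X Y)
      (f : hcat W X),
    fmap (lax_hom W Z) (assoc h g f) \c lax_comp (comp1 h g) f
      \c comp2 (lax_comp h g) (idm (lax_hom W X f))
    = lax_comp h (comp1 g f)
      \c comp2 (idm (lax_hom Y Z h)) (lax_comp g f)
      \c assoc (lax_hom Y Z h) (lax_hom X Y g) (lax_hom W X f)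
}.

Record cell_map (A B : bicategory) := CellMap {
  map0 : A -> B;
  map1 : forall X Y : A, hcat X Y -> hcat (map0 X) (map0 Y)
}.

Definition underlying (A B : bicategory) (P : lax_functor A B) : cell_map A B :=
  {| map0 := P; map1 := fun X Y => lax_hom P X Y |}.

Definition discrete (T : Type) : category := {|
  ob := T;
  hom := fun x y => x = y;
  idm := fun x => erefl x;
  compose := fun x y z (q : y = z) (p : x = y) => etrans p q;
  comp_idl := fun _ _ _ => Prop_irrelevance _ _;
  comp_idr := fun _ _ _ => Prop_irrelevance _ _;
  compA := fun _ _ _ _ _ _ _ => Prop_irrelevance _ _
|}.

Lemma discrete_eq (T : Type) (x y : discrete T) (p q : hom x y) : p = q.
Proof. exact: (@Prop_irrelevance (x = y :> T) p q). Qed.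

Lemma discrete_iso (T : Type) (x y : discrete T) (p : hom x y) : is_iso p.
Proof. by exists (esym p : hom y x); split; apply: discrete_eq. Qed.

Definition locally_discrete (C : category) : bicategory.
Proof.
refine (@Bicategory C (fun X Y => discrete (hom X Y)) (fun X => idm X)
  (fun X Y Z g f => g \c f)
  (fun X Y Z g g' f f' (q : g = g') (p : f = f') => f_equal2 compose q p)
  _ _ (fun W X Y Z h g f => esym (compA h g f)) _ _
  (fun X Y f => comp_idl f) _ _ (fun X Y f => comp_idr f) _ _ _ _);
  by move=> *; (apply: discrete_iso || apply: discrete_eq).
Defined.

Record pushout (C : category) (Y W V : C) (f : hom Y W) (g : hom Y V) :=
  Pushout {
  po :> C;
  po_inl : hom W po;
  po_inr : hom V po;
  po_comm : po_inl \c f = po_inr \c g;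
  (* the mediating morphism, determined by [po_unique] *)
  po_desc : forall (Q : C) (u : hom W Q) (v : hom V Q),
    u \c f = v \c g -> hom po Q;
  po_descl : forall Q u v (e : u \c f = v \c g), @po_desc Q u v e \c po_inl = u;
  po_descr : forall Q u v (e : u \c f = v \c g), @po_desc Q u v e \c po_inr = v;
  po_unique : forall (Q : C) (h h' : hom po Q),
    h \c po_inl = h' \c po_inl -> h \c po_inr = h' \c po_inr -> h = h'
}.
Arguments po_inl {C Y W V f g} p : rename.
Arguments po_inr {C Y W V f g} p : rename.
Arguments po_desc {C Y W V f g} p {Q u v} e : rename.

Definition chosen_pushouts (C : category) : Type :=
  forall (Y W V : C) (f : hom Y W) (g : hom Y V), pushout f g.

Record cospan (C : category) (X Y : C) := Cospan {
  apex : C;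
  legl : hom X apex;
  legr : hom Y apex
}.
Arguments Cospan {C X Y apex} legl legr.

Record cospan_hom (C : category) (X Y : C) (F G : cospan X Y) := CospanHom {
  cmap : hom (apex F) (apex G);
  cmap_legl : cmap \c legl F = legl G;
  cmap_legr : cmap \c legr F = legr G
}.

Lemma cospan_hom_eq (C : category) (X Y : C) (F G : cospan X Y)
  (d d' : cospan_hom F G) : cmap d = cmap d' -> d = d'.
Proof.
case: d d' => [d dl dr] [d' dl' dr'] /= e; rewrite -{}e in dl' dr' *.
by rewrite (Prop_irrelevance dl dl') (Prop_irrelevance dr dr').
Qed.

Section CospanCategory.
Variables (C : category) (X Y : C).

Definition cospan_id (F : cospan X Y) : cospan_hom F F :=
  CospanHom (comp_idl (legl F)) (comp_idl (legr F)).

Definition cospan_vcomp (F G H : cospan X Y)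
  (e : cospan_hom G H) (d : cospan_hom F G) : cospan_hom F H.
Proof.
refine (@CospanHom C X Y F H (cmap e \c cmap d) _ _).
- abstract (by rewrite -compA !cmap_legl).
- abstract (by rewrite -compA !cmap_legr).
Defined.

Definition cospan_cat : category.
Proof.
refine (@Category (cospan X Y) (@cospan_hom C X Y) cospan_id cospan_vcomp _ _ _).
- by move=> F G d; apply: cospan_hom_eq; apply: comp_idl.
- by move=> F G d; apply: cospan_hom_eq; apply: comp_idr.
- by move=> F G H K d e f; apply: cospan_hom_eq; apply: compA.
Defined.

End CospanCategory.

Section CoSpan.
Variables (C : category) (PO : chosen_pushouts C).

Definition cospan_id1 (X : C) : cospan X X := Cospan (idm X) (idm X).

Definition cospan_po (X Y Z : C) (G : cospan Y Z) (F : cospan X Y) :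
  pushout (legr F) (legl G) := PO (legr F) (legl G).

Definition cospan_comp (X Y Z : C) (G : cospan Y Z) (F : cospan X Y) :
  cospan X Z :=
  Cospan (po_inl (cospan_po G F) \c legl F) (po_inr (cospan_po G F) \c legr G).

Lemma cospan_ump_l (X Y Z : C) (G : cospan Y Z) (F : cospan X Y)
  (K : cospan X Z) (u : hom (apex F) (apex K)) (v : hom (apex G) (apex K))
  (e : u \c legr F = v \c legl G) (ul : u \c legl F = legl K) :
  po_desc (cospan_po G F) e \c legl (cospan_comp G F) = legl K.
Proof. by rewrite /= compA po_descl. Qed.

Lemma cospan_ump_r (X Y Z : C) (G : cospan Y Z) (F : cospan X Y)
  (K : cospan X Z) (u : hom (apex F) (apex K)) (v : hom (apex G) (apex K))
  (e : u \c legr F = v \c legl G) (vr : v \c legr G = legr K) :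
  po_desc (cospan_po G F) e \c legr (cospan_comp G F) = legr K.
Proof. by rewrite /= compA po_descr. Qed.

Definition cospan_ump (X Y Z : C) (G : cospan Y Z) (F : cospan X Y)
  (K : cospan X Z) (u : hom (apex F) (apex K)) (v : hom (apex G) (apex K))
  (e : u \c legr F = v \c legl G) (ul : u \c legl F = legl K)
  (vr : v \c legr G = legr K) : cospan_hom (cospan_comp G F) K :=
  @CospanHom C X Z (cospan_comp G F) K (po_desc (cospan_po G F) e)
    (cospan_ump_l e ul) (cospan_ump_r e vr).

Definition cospan_comp2 (X Y Z : C) (G G' : cospan Y Z) (F F' : cospan X Y)
  (b : cospan_hom G G') (a : cospan_hom F F') :
  cospan_hom (cospan_comp G F) (cospan_comp G' F').
Proof.
refine (@cospan_ump X Y Z G F (cospan_comp G' F')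
  (po_inl (cospan_po G' F') \c cmap a) (po_inr (cospan_po G' F') \c cmap b) _ _ _).
- abstract (by rewrite -!compA cmap_legl cmap_legr po_comm).
- abstract (by rewrite -!compA cmap_legl).
- abstract (by rewrite -!compA cmap_legr).
Defined.

Section Assoc.
Variables (W X Y Z : C) (H : cospan Y Z) (G : cospan X Y) (F : cospan W X).

Lemma assoc_comm :
  po_inl (cospan_po (cospan_comp H G) F) \c legr F
  = po_inr (cospan_po (cospan_comp H G) F) \c po_inl (cospan_po H G) \c legl G.
Proof. by rewrite po_comm /= compA. Qed.

Lemma assocV_comm :
  po_inl (cospan_po H (cospan_comp G F)) \c po_inr (cospan_po G F) \c legr G
  = po_inr (cospan_po H (cospan_comp G F)) \c legl H.
Proof. by rewrite -po_comm /= compA. Qed.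

End Assoc.

Definition cospan_assoc (W X Y Z : C)
  (H : cospan Y Z) (G : cospan X Y) (F : cospan W X) :
  cospan_hom (cospan_comp (cospan_comp H G) F)
             (cospan_comp H (cospan_comp G F)).
Proof.
pose p := cospan_po H (cospan_comp G F).
refine (@cospan_ump W X Z (cospan_comp H G) F
  (cospan_comp H (cospan_comp G F)) (po_inl p \c po_inl (cospan_po G F))
  (po_desc (cospan_po H G) (assocV_comm H G F)) _ _ _).
- abstract (by rewrite /= compA po_descl -!compA po_comm).
- abstract (by rewrite /= compA).
- abstract (by rewrite /= compA po_descr).
Defined.

Definition cospan_assocV (W X Y Z : C)
  (H : cospan Y Z) (G : cospan X Y) (F : cospan W X) :
  cospan_hom (cospan_comp H (cospan_comp G F))
             (cospan_comp (cospan_comp H G) F).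
Proof.
pose p := cospan_po (cospan_comp H G) F.
refine (@cospan_ump W Y Z H (cospan_comp G F)
  (cospan_comp (cospan_comp H G) F)
  (po_desc (cospan_po G F) (assoc_comm H G F)) (po_inr p \c po_inr (cospan_po H G))
  _ _ _).
- abstract (by rewrite /= compA po_descr -!compA po_comm).
- abstract (by rewrite /= compA po_descl).
- abstract (by rewrite /= compA).
Defined.

Definition cospan_lunit (X Y : C) (F : cospan X Y) :
  cospan_hom (cospan_comp (cospan_id1 Y) F) F.
Proof.
refine (@cospan_ump X Y Y (cospan_id1 Y) F F (idm _) (legr F) _ _ _).
- abstract (by rewrite /= comp_idl comp_idr).
- abstract (by rewrite comp_idl).
- abstract (by rewrite /= comp_idr).
Defined.

Definition cospan_lunitV (X Y : C) (F : cospan X Y) :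
  cospan_hom F (cospan_comp (cospan_id1 Y) F).
Proof.
refine (@CospanHom C X Y F (cospan_comp (cospan_id1 Y) F)
  (po_inl (cospan_po (cospan_id1 Y) F)) _ _).
- by [].
- abstract (by rewrite po_comm).
Defined.

Definition cospan_runit (X Y : C) (F : cospan X Y) :
  cospan_hom (cospan_comp F (cospan_id1 X)) F.
Proof.
refine (@cospan_ump X X Y F (cospan_id1 X) F (legl F) (idm _) _ _ _).
- abstract (by rewrite /= comp_idl comp_idr).
- abstract (by rewrite /= comp_idr).
- abstract (by rewrite comp_idl).
Defined.

Definition cospan_runitV (X Y : C) (F : cospan X Y) :
  cospan_hom F (cospan_comp F (cospan_id1 X)).
Proof.
refine (@CospanHom C X Y F (cospan_comp F (cospan_id1 X))
  (po_inr (cospan_po F (cospan_id1 X))) _ _).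
- abstract (by rewrite -po_comm).
- by [].
Defined.

Lemma po_desclA (Y W V Q T : C) (f : hom Y W) (g : hom Y V) (p : pushout f g)
  (u : hom W Q) (v : hom V Q) (e : u \c f = v \c g) (k : hom Q T) :
  k \c po_desc p e \c po_inl p = k \c u.
Proof. by rewrite -compA po_descl. Qed.

Lemma po_descrA (Y W V Q T : C) (f : hom Y W) (g : hom Y V) (p : pushout f g)
  (u : hom W Q) (v : hom V Q) (e : u \c f = v \c g) (k : hom Q T) :
  k \c po_desc p e \c po_inr p = k \c v.
Proof. by rewrite -compA po_descr. Qed.

Local Ltac po_simp :=
  rewrite /= ?(compA, comp_idl, comp_idr, po_descl, po_descr, po_desclA, po_descrA).
Local Ltac po_ext := repeat (apply: po_unique; po_simp); po_simp => //.

Definition coSpan : bicategory.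
Proof.
refine (@Bicategory C (fun X Y => cospan_cat X Y) cospan_id1 cospan_comp
  cospan_comp2 _ _ cospan_assoc _ _ cospan_lunit _ _ cospan_runit _ _ _ _).
- by move=> *; apply: cospan_hom_eq; po_ext.
- by move=> *; apply: cospan_hom_eq; po_ext.
- move=> W X Y Z H G F; exists (cospan_assocV H G F).
  by split; apply: cospan_hom_eq; po_ext.
- by move=> *; apply: cospan_hom_eq; po_ext.
- move=> X Y F; exists (cospan_lunitV F).
  split; apply: cospan_hom_eq; po_ext.
  by rewrite (po_comm (cospan_po (cospan_id1 Y) F)) comp_idr.
- by move=> X Y F F' a; apply: cospan_hom_eq; po_ext; rewrite cmap_legr.
- move=> X Y F; exists (cospan_runitV F).
  split; apply: cospan_hom_eq; po_ext.
  by rewrite -(po_comm (cospan_po F (cospan_id1 X))) comp_idr.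
- by move=> X Y F F' a; apply: cospan_hom_eq; po_ext; rewrite cmap_legl.
- move=> X Y Z G F; apply: cospan_hom_eq; po_ext.
  + by rewrite [LHS]comp_idr [RHS]po_descl [RHS]comp_idr.
  + exact: po_comm.
- by move=> *; apply: cospan_hom_eq; po_ext.
Defined.

End CoSpan.

Lemma rmorph_eq (R S : pzRingType) (f g : {rmorphism R -> S}) :
  f =1 g -> f = g.
Proof.
case: f g => [f [[fD] [fM]]] [g [[gD] [gM]]] /= /funext e.
rewrite -{}e in gD gM *.
by rewrite (Prop_irrelevance fD gD) (Prop_irrelevance fM gM).
Qed.

Definition ring_comp (R S T : pzRingType) (g : {rmorphism S -> T})
  (f : {rmorphism R -> S}) : {rmorphism R -> T} := g \o f.

Definition Ring : category.
Proof.
refine (@Category pzRingType (fun R S => {rmorphism R -> S})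
  (fun R => idfun : {rmorphism R -> R}) ring_comp _ _ _);
  by move=> *; apply: rmorph_eq.
Defined.

(* Chosen pushouts exist in [Ring]: the amalgamated free product of
   [f] and [g] is the set of ring expressions in the elements of [W] and [V]
   modulo the smallest congruence imposing the ring axioms, the ring structures
   of [W] and [V], and [f y = g y]. *)
Section Amalgam.
Variables (Y W V : pzRingType) (f : {rmorphism Y -> W}) (g : {rmorphism Y -> V}).

Inductive expr : Type :=
| EL of W
| ER of V
| EO
| EI
| EA of expr & expr
| EN of expr
| EM of expr & expr.

Inductive eqe : expr -> expr -> Prop :=
| eqe_refl x : eqe x x
| eqe_sym x y : eqe x y -> eqe y x
| eqe_trans x y z : eqe x y -> eqe y z -> eqe x z
| eqe_A x x' y y' : eqe x x' -> eqe y y' -> eqe (EA x y) (EA x' y')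
| eqe_N x x' : eqe x x' -> eqe (EN x) (EN x')
| eqe_M x x' y y' : eqe x x' -> eqe y y' -> eqe (EM x y) (EM x' y')
| eqe_addA x y z : eqe (EA x (EA y z)) (EA (EA x y) z)
| eqe_addC x y : eqe (EA x y) (EA y x)
| eqe_add0 x : eqe (EA EO x) x
| eqe_addN x : eqe (EA (EN x) x) EO
| eqe_mulA x y z : eqe (EM x (EM y z)) (EM (EM x y) z)
| eqe_mul1l x : eqe (EM EI x) x
| eqe_mul1r x : eqe (EM x EI) x
| eqe_mulDl x y z : eqe (EM (EA x y) z) (EA (EM x z) (EM y z))
| eqe_mulDr x y z : eqe (EM x (EA y z)) (EA (EM x y) (EM x z))
| eqe_L1 : eqe (EL 1) EI
| eqe_LB a b : eqe (EL (a - b)) (EA (EL a) (EN (EL b)))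
| eqe_LM a b : eqe (EL (a * b)) (EM (EL a) (EL b))
| eqe_R1 : eqe (ER 1) EI
| eqe_RB a b : eqe (ER (a - b)) (EA (ER a) (EN (ER b)))
| eqe_RM a b : eqe (ER (a * b)) (EM (ER a) (ER b))
| eqe_glue y : eqe (EL (f y)) (ER (g y)).

HB.instance Definition _ := gen_eqMixin expr.
HB.instance Definition _ := gen_choiceMixin expr.

Definition eqeb : rel expr := fun x y => `[< eqe x y >].

Lemma eqeb_refl : reflexive eqeb.
Proof. by move=> x; apply/asboolP/eqe_refl. Qed.
Lemma eqeb_sym : symmetric eqeb.
Proof. by move=> x y; apply/asboolP/asboolP; apply: eqe_sym. Qed.
Lemma eqeb_trans : transitive eqeb.
Proof. by move=> y x z /asboolP xy /asboolP yz; apply/asboolP/(eqe_trans xy). Qed.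

Canonical eqe_equiv := EquivRel eqeb eqeb_refl eqeb_sym eqeb_trans.

Local Open Scope quotient_scope.

Definition amalgam : Type := {eq_quot eqe_equiv}.
HB.instance Definition _ := Choice.on amalgam.
HB.instance Definition _ := EqQuotient.on amalgam.

Lemma amalgamP (x y : expr) : eqe x y <-> \pi_amalgam x = \pi_amalgam y.
Proof.
split=> [xy|/eqmodP/asboolP //].
by apply/eqmodP/asboolP.
Qed.

Lemma amalgam_repr (x : expr) : eqe (repr (\pi_amalgam x)) x.
Proof. by apply/amalgamP; rewrite reprK. Qed.

Definition am_zero : amalgam := \pi_amalgam EO.
Definition am_one : amalgam := \pi_amalgam EI.
Definition am_add : amalgam -> amalgam -> amalgam := lift_op2 amalgam EA.
Definition am_opp : amalgam -> amalgam := lift_op1 amalgam EN.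
Definition am_mul : amalgam -> amalgam -> amalgam := lift_op2 amalgam EM.

Lemma am_addE x y : am_add (\pi_amalgam x) (\pi_amalgam y) = \pi_amalgam (EA x y).
Proof. by rewrite /am_add -lock; apply/amalgamP/eqe_A; apply: amalgam_repr. Qed.
Lemma am_oppE x : am_opp (\pi_amalgam x) = \pi_amalgam (EN x).
Proof. by rewrite /am_opp -lock; apply/amalgamP/eqe_N; apply: amalgam_repr. Qed.
Lemma am_mulE x y : am_mul (\pi_amalgam x) (\pi_amalgam y) = \pi_amalgam (EM x y).
Proof. by rewrite /am_mul -lock; apply/amalgamP/eqe_M; apply: amalgam_repr. Qed.

Local Definition amE := (am_addE, am_oppE, am_mulE).
Local Ltac am_ax H :=
  repeat (elim/quotW; move=> ?); rewrite /am_zero /am_one ?amE; apply/amalgamP; exact: H.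

Fact am_addA : associative am_add. Proof. am_ax eqe_addA. Qed.
Fact am_addC : commutative am_add. Proof. am_ax eqe_addC. Qed.
Fact am_add0 : left_id am_zero am_add. Proof. am_ax eqe_add0. Qed.
Fact am_addN : left_inverse am_zero am_opp am_add. Proof. am_ax eqe_addN. Qed.
Fact am_mulA : associative am_mul. Proof. am_ax eqe_mulA. Qed.
Fact am_mul1l : left_id am_one am_mul. Proof. am_ax eqe_mul1l. Qed.
Fact am_mul1r : right_id am_one am_mul. Proof. am_ax eqe_mul1r. Qed.
Fact am_mulDl : left_distributive am_mul am_add. Proof. am_ax eqe_mulDl. Qed.
Fact am_mulDr : right_distributive am_mul am_add. Proof. am_ax eqe_mulDr. Qed.

HB.instance Definition _ :=
  GRing.isZmodule.Build amalgam am_addA am_addC am_add0 am_addN.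
HB.instance Definition _ := GRing.Zmodule_isPzRing.Build amalgam
  am_mulA am_mul1l am_mul1r am_mulDl am_mulDr.

Definition am_inl (w : W) : amalgam := \pi_amalgam (EL w).
Definition am_inr (v : V) : amalgam := \pi_amalgam (ER v).

Fact am_inl_zmod : zmod_morphism am_inl.
Proof.
move=> a b; rewrite -[RHS]/(am_add _ (am_opp _)) !amE; apply/amalgamP.
exact: eqe_LB.
Qed.
Fact am_inl_monoid : monoid_morphism am_inl.
Proof.
split=> [|a b]; first exact/amalgamP/eqe_L1.
by rewrite -[RHS]/(am_mul _ _) amE; apply/amalgamP/eqe_LM.
Qed.
Fact am_inr_zmod : zmod_morphism am_inr.
Proof.
move=> a b; rewrite -[RHS]/(am_add _ (am_opp _)) !amE; apply/amalgamP.
exact: eqe_RB.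
Qed.
Fact am_inr_monoid : monoid_morphism am_inr.
Proof.
split=> [|a b]; first exact/amalgamP/eqe_R1.
by rewrite -[RHS]/(am_mul _ _) amE; apply/amalgamP/eqe_RM.
Qed.

HB.instance Definition _ :=
  GRing.isZmodMorphism.Build W amalgam am_inl am_inl_zmod.
HB.instance Definition _ :=
  GRing.isMonoidMorphism.Build W amalgam am_inl am_inl_monoid.
HB.instance Definition _ :=
  GRing.isZmodMorphism.Build V amalgam am_inr am_inr_zmod.
HB.instance Definition _ :=
  GRing.isMonoidMorphism.Build V amalgam am_inr am_inr_monoid.

Section Desc.
Variables (Q : pzRingType) (u : {rmorphism W -> Q}) (v : {rmorphism V -> Q}).
Hypothesis uv : forall y, u (f y) = v (g y).

Fixpoint eval (x : expr) : Q :=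
  match x with
  | EL w => u w
  | ER w => v w
  | EO => 0
  | EI => 1
  | EA x y => eval x + eval y
  | EN x => - eval x
  | EM x y => eval x * eval y
  end.

Lemma eval_eqe x y : eqe x y -> eval x = eval y.
Proof.
elim=> //= *; rewrite ?(rmorph1, rmorphB, rmorphM) //; try congruence.
- exact: addrA.
- exact: addrC.
- exact: add0r.
- exact: addNr.
- exact: mulrA.
- exact: mul1r.
- exact: mulr1.
- exact: mulrDl.
- exact: mulrDr.
Qed.

(* [uv] is an argument so that the morphism instances below can be inferred *)
Definition am_desc of (forall y, u (f y) = v (g y)) :=
  fun x : amalgam => eval (repr x).

Lemma am_descE x : am_desc uv (\pi_amalgam x) = eval x.
Proof. exact/eval_eqe/amalgam_repr. Qed.

Fact am_desc_zmod : zmod_morphism (am_desc uv).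
Proof.
elim/quotW=> x; elim/quotW=> y.
by rewrite -[X in am_desc uv X]/(am_add _ (am_opp _)) !amE !am_descE.
Qed.
Fact am_desc_monoid : monoid_morphism (am_desc uv).
Proof.
split; first exact: am_descE.
elim/quotW=> x; elim/quotW=> y.
by rewrite -[X in am_desc uv X]/(am_mul _ _) !amE !am_descE.
Qed.

HB.instance Definition _ :=
  GRing.isZmodMorphism.Build amalgam Q (am_desc uv) am_desc_zmod.
HB.instance Definition _ :=
  GRing.isMonoidMorphism.Build amalgam Q (am_desc uv) am_desc_monoid.

Definition am_desc_rmorph : {rmorphism amalgam -> Q} := am_desc uv.

End Desc.

Lemma am_unique (Q : pzRingType) (h h' : {rmorphism amalgam -> Q}) :
  h \o am_inl =1 h' \o am_inl -> h \o am_inr =1 h' \o am_inr -> h = h'.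
Proof.
move=> hl hr; apply: rmorph_eq; elim/quotW.
elim=> [w|w|||x IHx y IHy|x IHx|x IHx y IHy].
- exact: hl.
- exact: hr.
- by rewrite -[\pi_amalgam EO]/(0 : amalgam) !rmorph0.
- by rewrite -[\pi_amalgam EI]/(1 : amalgam) !rmorph1.
- by rewrite -am_addE -[am_add _ _]/(_ + _) !rmorphD IHx IHy.
- by rewrite -am_oppE -[am_opp _]/(- _) !rmorphN IHx.
- by rewrite -am_mulE -[am_mul _ _]/(_ * _) !rmorphM IHx IHy.
Qed.

End Amalgam.

Definition Ring_pushouts : chosen_pushouts Ring.
Proof.
move=> Y W V f g.
refine (@Pushout Ring Y W V f g (amalgam f g : pzRingType)
  (am_inl f g : {rmorphism W -> amalgam f g})
  (am_inr f g : {rmorphism V -> amalgam f g}) _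
  (fun Q u v e => am_desc_rmorph
    (fun y => congr1 (fun h : {rmorphism Y -> Q} => h y) e))
  _ _ _).
- by apply: rmorph_eq => y; apply/amalgamP/eqe_glue.
- by move=> Q u v e; apply: rmorph_eq => x; apply: am_descE.
- by move=> Q u v e; apply: rmorph_eq => x; apply: am_descE.
- move=> Q h h' hl hr; apply: am_unique => x.
  + exact: (congr1 (fun k : {rmorphism W -> Q} => k x) hl).
  + exact: (congr1 (fun k : {rmorphism V -> Q} => k x) hr).
Defined.

Definition center (R : pzRingType) : {pred R} :=
  fun x => `[< forall y : R, x * y = y * x >].
Arguments center R : clear implicits.

Definition centralizer (R S : pzRingType) (f : {rmorphism R -> S}) : {pred S} :=
  fun s => `[< forall r : R, s * f r = f r * s >].

Lemma centerP (R : pzRingType) (x : R) :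
  reflect (forall y : R, x * y = y * x) (x \in center R).
Proof. exact: asboolP. Qed.

Lemma centralizerP (R S : pzRingType) (f : {rmorphism R -> S}) (s : S) :
  reflect (forall r : R, s * f r = f r * s) (s \in centralizer f).
Proof. exact: asboolP. Qed.

Lemma center_subring (R : pzRingType) : subring_closed (center R).
Proof.
split=> [|x y /centerP xc /centerP yc|x y /centerP xc /centerP yc];
  apply/centerP => z.
- by rewrite mul1r mulr1.
- by rewrite mulrBl mulrBr xc yc.
- by rewrite -mulrA yc mulrA xc mulrA.
Qed.

Lemma centralizer_subring (R S : pzRingType) (f : {rmorphism R -> S}) :
  subring_closed (centralizer f).
Proof.
split=> [|x y /centralizerP xc /centralizerP yc
         |x y /centralizerP xc /centralizerP yc]; apply/centralizerP => z.
- by rewrite mul1r mulr1.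
- by rewrite mulrBl mulrBr xc yc.
- by rewrite -mulrA yc mulrA xc mulrA.
Qed.

HB.instance Definition _ (R : pzRingType) :=
  GRing.isSubringClosed.Build R (center R) (@center_subring R).
HB.instance Definition _ (R S : pzRingType) (f : {rmorphism R -> S}) :=
  GRing.isSubringClosed.Build S (centralizer f) (centralizer_subring f).

Record center_ring (R : pzRingType) := CenterRing {
  center_val :> R;
  center_valP : center_val \in center R
}.
HB.instance Definition _ (R : pzRingType) := [isSub for @center_val R].
HB.instance Definition _ (R : pzRingType) := [Choice of center_ring R by <:].
HB.instance Definition _ (R : pzRingType) :=
  GRing.SubChoice_isSubPzRing.Build _ _ (center_ring R) (@center_subring R).

Record centralizer_ring (R S : pzRingType) (f : {rmorphism R -> S}) :=
  CentralizerRing {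
  centralizer_val :> S;
  centralizer_valP : centralizer_val \in centralizer f
}.
HB.instance Definition _ (R S : pzRingType) (f : {rmorphism R -> S}) :=
  [isSub for @centralizer_val R S f].
HB.instance Definition _ (R S : pzRingType) (f : {rmorphism R -> S}) :=
  [Choice of centralizer_ring f by <:].
HB.instance Definition _ (R S : pzRingType) (f : {rmorphism R -> S}) :=
  GRing.SubChoice_isSubPzRing.Build _ _ (centralizer_ring f)
    (centralizer_subring f).

Section CenterCospan.
Variables (R S : pzRingType) (f : {rmorphism R -> S}).

Lemma center_legl_subproof (r : center_ring R) : f (val r) \in centralizer f.
Proof.
apply/centralizerP => x; rewrite -!rmorphM.
by have /centerP -> := valP r.
Qed.

Lemma center_legr_subproof (s : center_ring S) : val s \in centralizer f.
Proof. by apply/centralizerP => x; have /centerP -> := valP s. Qed.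

Definition center_legl (r : center_ring R) : centralizer_ring f :=
  CentralizerRing (center_legl_subproof r).

Definition center_legr (s : center_ring S) : centralizer_ring f :=
  CentralizerRing (center_legr_subproof s).

Fact center_legl_zmod : zmod_morphism center_legl.
Proof. by move=> x y; apply: val_inj; rewrite /= !rmorphB. Qed.
Fact center_legl_monoid : monoid_morphism center_legl.
Proof.
by split=> [|x y]; apply: val_inj; rewrite /= ?rmorphM /= ?rmorphM ?rmorph1.
Qed.
Fact center_legr_zmod : zmod_morphism center_legr.
Proof. by move=> x y; apply: val_inj. Qed.
Fact center_legr_monoid : monoid_morphism center_legr.
Proof. by split=> [|x y]; apply: val_inj. Qed.

HB.instance Definition _ := GRing.isZmodMorphism.Build
  (center_ring R) (centralizer_ring f) center_legl center_legl_zmod.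
HB.instance Definition _ := GRing.isMonoidMorphism.Build
  (center_ring R) (centralizer_ring f) center_legl center_legl_monoid.
HB.instance Definition _ := GRing.isZmodMorphism.Build
  (center_ring S) (centralizer_ring f) center_legr center_legr_zmod.
HB.instance Definition _ := GRing.isMonoidMorphism.Build
  (center_ring S) (centralizer_ring f) center_legr center_legr_monoid.

Definition center_cospan :
    @cospan Ring (center_ring R : pzRingType) (center_ring S : pzRingType) :=
  @Cospan Ring _ _ (centralizer_ring f : pzRingType)
    (center_legl : {rmorphism center_ring R -> centralizer_ring f})
    (center_legr : {rmorphism center_ring S -> centralizer_ring f}).

End CenterCospan.

Definition center_map (PO : chosen_pushouts Ring) :
    cell_map (locally_discrete Ring) (coSpan PO) :=
  @CellMap (locally_discrete Ring) (coSpan PO)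
    (fun R => center_ring R : pzRingType)
    (fun R S f => center_cospan f).

(* Main.v *)
From HB Require Import structures.
From mathcomp Require Import all_boot all_algebra.
Require Import Defs.

(** Centralizers behave covariantly in a way in which centers do not.  For
    [f : R -> S] and [g : S -> T], if [s] commutes with the image of [f] then
    [g s] commutes with the image of [g f], and if [t] commutes with the image
    of [g] then it commutes with the image of [g f], which is smaller.  This
    gives ring morphisms [Z(f) -> Z(gf) <- Z(g)], the first induced by [g] and
    the second an inclusion.  They agree on [Z(S)], so they glue to a morphism
    from the pushout of [Z(f) <- Z(S) -> Z(g)] to [Z(gf)], the comparison cell
    of the lax functor.  The unit cell is the identification of [Z(R)] with the
    centralizer of the identity of [R].

    A cell out of a composite cospan is determined by its restrictions to the
    two (or, for a double composite, three) factors.  Restricted to a factor,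
    both sides of each coherence equation apply one and the same composite of
    the given homomorphisms to the underlying elements: to [s] in [Z(f)] the two
    sides of lax associativity for [f], [g], [h] assign [h (g s)], to [t] in
    [Z(g)] they assign [h t], and they fix the elements of [Z(h)].  Hence the
    coherence laws are first reduced to such restrictions in an arbitrary
    category with pushouts ([cospan_lax_nat], [cospan_lax_lunit],
    [cospan_lax_runit], [cospan_lax_assoc]), and the restrictions are then
    compared elementwise with [centralizer_hom_eq]. *)

Set Implicit Arguments.
Unset Strict Implicit.
Unset Printing Implicit Defensive.

Import GRing.Theory.
Local Open Scope ring_scope.
Local Open Scope cat_scope.

(** * Cells out of composite cospans *)

Section CompositeCospans.
Variables (C : category) (PO : chosen_pushouts C).

Lemma cospan_comp_ext (X Y Z : C) (G : cospan Y Z) (F : cospan X Y)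
    (K : cospan X Z) (d d' : cospan_hom (cospan_comp PO G F) K) :
  cmap d \c po_inl (cospan_po PO G F) = cmap d' \c po_inl (cospan_po PO G F) ->
  cmap d \c po_inr (cospan_po PO G F) = cmap d' \c po_inr (cospan_po PO G F) ->
  d = d'.
Proof. by move=> el er; apply: cospan_hom_eq; apply: po_unique. Qed.

Lemma cospan_lax_nat (X Y Z : C) (G G' : cospan Y Z) (F F' : cospan X Y)
    (K K' : cospan X Z) (m : cospan_hom (cospan_comp PO G F) K)
    (m' : cospan_hom (cospan_comp PO G' F') K') (t : cospan_hom K K')
    (b : cospan_hom G G') (a : cospan_hom F F') :
  cmap m' \c po_inl (cospan_po PO G' F') \c cmap a
    = cmap t \c (cmap m \c po_inl (cospan_po PO G F)) ->
  cmap m' \c po_inr (cospan_po PO G' F') \c cmap b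
    = cmap t \c (cmap m \c po_inr (cospan_po PO G F)) ->
  cospan_vcomp m' (cospan_comp2 PO b a) = cospan_vcomp t m.
Proof.
move=> eF eG; apply: cospan_comp_ext; rewrite /= -!compA.
  by rewrite po_descl compA.
by rewrite po_descr compA.
Qed.

(** Only the restriction to [F] matters: the other factor of the source is an
    identity cospan, whose apex is covered by the shared leg. *)
Lemma cospan_lax_lunit (X Y : C) (F K : cospan X Y) (U : cospan Y Y)
    (t : cospan_hom K F) (m : cospan_hom (cospan_comp PO U F) K)
    (i : cospan_hom (cospan_id1 Y) U) :
  cmap t \c (cmap m \c po_inl (cospan_po PO U F)) = idm (apex F) ->
  cospan_vcomp (cospan_vcomp t m) (cospan_comp2 PO i (cospan_id F))
  = cospan_lunit PO F.
Proof.
move=> tm; apply: cospan_comp_ext; rewrite /= -!compA.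
  by rewrite !po_descl /= comp_idr.
rewrite !po_descr.
have -> : cmap i = legl U by rewrite -(cmap_legl i) comp_idr.
by rewrite -po_comm !compA -[_ \c cmap m \c _]compA tm comp_idl.
Qed.

Lemma cospan_lax_runit (X Y : C) (F K : cospan X Y) (U : cospan X X)
    (t : cospan_hom K F) (m : cospan_hom (cospan_comp PO F U) K)
    (i : cospan_hom (cospan_id1 X) U) :
  cmap t \c (cmap m \c po_inr (cospan_po PO F U)) = idm (apex F) ->
  cospan_vcomp (cospan_vcomp t m) (cospan_comp2 PO (cospan_id F) i)
  = cospan_runit PO F.
Proof.
move=> tm; apply: cospan_comp_ext; rewrite /= -!compA.
  rewrite !po_descl.
  have -> : cmap i = legr U by rewrite -(cmap_legr i) comp_idr.
  by rewrite po_comm !compA -[_ \c cmap m \c _]compA tm comp_idl.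
by rewrite !po_descr /= comp_idr.
Qed.

(** The apex of the source is a pushout of a pushout, so a cell out of it is
    determined on the apices of [F], [G] and [H], one hypothesis for each; the
    associator only renames the three inclusions. *)
Lemma cospan_lax_assoc (W X Y Z : C) (H : cospan Y Z) (G : cospan X Y)
    (F : cospan W X) (HG : cospan X Z) (GF : cospan W Y) (K K' : cospan W Z)
    (hg : cospan_hom (cospan_comp PO H G) HG)
    (gf : cospan_hom (cospan_comp PO G F) GF)
    (m : cospan_hom (cospan_comp PO HG F) K)
    (n : cospan_hom (cospan_comp PO H GF) K') (t : cospan_hom K K') :
  cmap t \c (cmap m \c po_inl (cospan_po PO HG F))
    = cmap n \c po_inl (cospan_po PO H GF)
        \c (cmap gf \c po_inl (cospan_po PO G F)) ->
  cmap t \c (cmap m \c po_inr (cospan_po PO HG F)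
      \c (cmap hg \c po_inl (cospan_po PO H G)))
    = cmap n \c po_inl (cospan_po PO H GF)
        \c (cmap gf \c po_inr (cospan_po PO G F)) ->
  cmap t \c (cmap m \c po_inr (cospan_po PO HG F)
      \c (cmap hg \c po_inr (cospan_po PO H G)))
    = cmap n \c po_inr (cospan_po PO H GF) ->
  cospan_vcomp (cospan_vcomp t m) (cospan_comp2 PO hg (cospan_id F))
  = cospan_vcomp (cospan_vcomp n (cospan_comp2 PO (cospan_id H) gf))
      (cospan_assoc PO H G F).
Proof.
rewrite !compA => eF eG eH; apply: cospan_comp_ext; rewrite /= ?compA.
  by rewrite !(po_desclA, compA) comp_idr.
rewrite !po_descrA; apply: po_unique; rewrite !compA.
  by rewrite !(po_desclA, compA).
by rewrite !po_descrA comp_idr.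
Qed.

End CompositeCospans.

(** * Morphisms between centralizers *)

Section CentralizerMap.
Variables (R R' S T : pzRingType) (f : {rmorphism R -> S})
  (k : {rmorphism R' -> T}) (h : {rmorphism S -> T}).
Hypothesis hfk : forall s, s \in centralizer f -> h s \in centralizer k.

(** The inclusion [hfk] is an argument so that the morphism instances can be
    found from the term [centralizer_map hfk]. *)
Definition centralizer_map
    of (forall s, s \in centralizer f -> h s \in centralizer k) :=
  fun s : centralizer_ring f => CentralizerRing (hfk (valP s)).

Fact centralizer_map_zmod : zmod_morphism (centralizer_map hfk).
Proof. by move=> x y; apply: val_inj; rewrite /= !rmorphB. Qed.
Fact centralizer_map_monoid : monoid_morphism (centralizer_map hfk).
Proof.
by split=> [|x y]; apply: val_inj; rewrite /= ?rmorphM /= ?rmorphM ?rmorph1.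
Qed.

HB.instance Definition _ := GRing.isZmodMorphism.Build (centralizer_ring f)
  (centralizer_ring k) (centralizer_map hfk) centralizer_map_zmod.
HB.instance Definition _ := GRing.isMonoidMorphism.Build (centralizer_ring f)
  (centralizer_ring k) (centralizer_map hfk) centralizer_map_monoid.

Definition centralizer_hom : @hom Ring
    (centralizer_ring f : pzRingType) (centralizer_ring k : pzRingType) :=
  (centralizer_map hfk : {rmorphism centralizer_ring f -> centralizer_ring k}).

End CentralizerMap.

(** The proofs of commutation carried by elements of a centralizer are
    irrelevant, so an equation between morphisms into it can be checked in the
    ambient ring. *)
Lemma centralizer_hom_eq (A R S : pzRingType) (f : {rmorphism R -> S})
    (u v : {rmorphism A -> centralizer_ring f}) :
  (forall a, val (u a) = val (v a)) -> u = v.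
Proof. by move=> uv; apply: rmorph_eq => a; apply/val_inj/uv. Qed.

Lemma centralizer_eq_sub (R S : pzRingType) (f g : {rmorphism R -> S}) :
  f = g -> forall s, s \in centralizer f ->
    (idfun : {rmorphism S -> S}) s \in centralizer g.
Proof. by move->. Qed.

Section Composite.
Variables (R S T : pzRingType).
Variables (g : {rmorphism S -> T}) (f : {rmorphism R -> S}).

Lemma centralizer_push s :
  s \in centralizer f -> g s \in centralizer (ring_comp g f).
Proof.
by move=> /centralizerP sf; apply/centralizerP => r; rewrite /= -!rmorphM sf.
Qed.

Lemma centralizer_pull t : t \in centralizer g ->
  (idfun : {rmorphism T -> T}) t \in centralizer (ring_comp g f).
Proof. by move=> /centralizerP tg; apply/centralizerP => r; apply: tg. Qed.

End Composite.

(** * The structure cells of the center *)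

(** Equal homomorphisms have equal centralizers, but as types these are only
    propositionally equal.  Transporting by a morphism that keeps the underlying
    element, instead of by a cast, makes its effect visible by computation. *)
Definition center_cell (R S : pzRingType) (f g : {rmorphism R -> S})
    (p : f = g) :
  @cospan_hom Ring _ _ (center_cospan f) (center_cospan g).
Proof.
refine (@CospanHom Ring _ _ (center_cospan f) (center_cospan g)
  (centralizer_hom (centralizer_eq_sub p)) _ _).
- by apply: centralizer_hom_eq => a /=; rewrite p.
- by apply: centralizer_hom_eq.
Defined.

Definition center_functor (R S : pzRingType) :
  functor (discrete {rmorphism R -> S})
    (@cospan_cat Ring (center_ring R : pzRingType) (center_ring S : pzRingType)).
Proof.
refine (@Functor (discrete {rmorphism R -> S}) (cospan_cat _ _)
  (@center_cospan R S) (@center_cell R S) _ _).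
- by move=> f; apply: cospan_hom_eq; apply: centralizer_hom_eq.
- by move=> f g h q p; apply: cospan_hom_eq; apply: centralizer_hom_eq.
Defined.

Definition center_unit (R : pzRingType) :
  cospan_hom (@cospan_id1 Ring (center_ring R : pzRingType))
    (center_cospan (idfun : {rmorphism R -> R})).
Proof.
refine (@CospanHom Ring _ _ (@cospan_id1 Ring (center_ring R : pzRingType))
  (center_cospan (idfun : {rmorphism R -> R}))
  (center_legr (idfun : {rmorphism R -> R})) _ _);
  by apply: centralizer_hom_eq.
Defined.

Section CenterComposite.
Variable PO : chosen_pushouts Ring.

Section Comparison.
Variables (R S T : pzRingType).
Variables (g : {rmorphism S -> T}) (f : {rmorphism R -> S}).

Definition center_mult :
  cospan_hom (cospan_comp PO (center_cospan g) (center_cospan f))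
    (center_cospan (ring_comp g f)).
Proof.
refine (@cospan_ump Ring PO _ _ _ (center_cospan g) (center_cospan f)
  (center_cospan (ring_comp g f)) (centralizer_hom (centralizer_push g (f := f)))
  (centralizer_hom (centralizer_pull f (g := g))) _ _ _);
  by apply: centralizer_hom_eq.
Defined.

Lemma center_mult_inl :
  cmap center_mult \c po_inl (cospan_po PO (center_cospan g) (center_cospan f))
  = centralizer_hom (centralizer_push g (f := f)).
Proof. exact: po_descl. Qed.

Lemma center_mult_inr :
  cmap center_mult \c po_inr (cospan_po PO (center_cospan g) (center_cospan f))
  = centralizer_hom (centralizer_pull f (g := g)).
Proof. exact: po_descr. Qed.

End Comparison.

Lemma center_mult_nat (R S T : pzRingType) (g g' : {rmorphism S -> T})
    (f f' : {rmorphism R -> S}) (b : g = g') (a : f = f') :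
  cospan_vcomp (center_mult g' f')
    (cospan_comp2 PO (center_cell b) (center_cell a))
  = cospan_vcomp (center_cell (f_equal2 (@ring_comp R S T) b a))
      (center_mult g f).
Proof.
apply: cospan_lax_nat; rewrite ?center_mult_inl ?center_mult_inr;
  apply: centralizer_hom_eq => s //=.
by rewrite b.
Qed.

Definition center_lax : lax_functor (locally_discrete Ring) (coSpan PO).
Proof.
refine (@LaxFunctor (locally_discrete Ring) (coSpan PO)
  (fun R => center_ring R : pzRingType) center_functor center_unit
  center_mult center_mult_nat _ _ _).
- move=> R S f; apply: cospan_lax_lunit.
  by rewrite center_mult_inl; apply: centralizer_hom_eq.
- move=> R S f; apply: cospan_lax_runit.
  by rewrite center_mult_inr; apply: centralizer_hom_eq.
- move=> Q R S T h g f; apply: cospan_lax_assoc;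
    rewrite ?center_mult_inl ?center_mult_inr; exact: centralizer_hom_eq.
Defined.

End CenterComposite.

Theorem theorem5p4 (PO : chosen_pushouts Ring) :
  exists Z : lax_functor (locally_discrete Ring) (coSpan PO),
    underlying Z = center_map PO.
Proof. by exists (center_lax PO). Qed.
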